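(* Let $X$ be a homogeneously self-similar graph with constant inner degree $b$. Then, for every positive integer $n$ and every $n$-cell $C_n$, $$|\delta C_n|=\Big(\frac{b}{\theta_X-1}\Big)^{n-1}\delta_X .$$
   Context: Graph $X$ with vertex set $VX$ and edge set $EX$ is connected, locally finite, infinite, without loops or multiple edges. $d_X$ is the graph distance and $\deg_X x$ the number of neighbours of $x$ in $X$. For $C\subset VX$, the boundary $\theta C$ is the set of vertices in $VX\setminus C$ adjacent to some vertex of $C$; the closure is $\overline{C}=C\cup\theta C$; $\hat C$ is the subgraph of $X$ spanned (induced) by $\overline{C}$; the edge boundary $\delta C$ is the set of edges connecting a vertex in $C$ with a vertex in $VX\setminus C$. For $F\subset VX$, $\mathcal{C}_XF$ denotes the set of connected components of $VX\setminus F$ (as vertex sets). The reduced graph $X_F$ has vertex set $F$, and two (distinct) vertices $x,y\in F$ are adjacent in $X_F$ iff there is $C\in\mathcal{C}_XF$ with $x,y\in\theta C$. $X$ is self-similar with respect to $F\subset VX$ and $\psi:VX\to F$ if: (F1) no two vertices of $F$ are adjacent in $X$; (F2) the intersection of the closures of two different components in $\mathcal{C}_XF$ contains at most one vertex; (F3) $\psi$ is a graph isomorphism from $X$ to $X_F$. Put $F^0=VX$, $F^n=\psi^n(VX)$ (so $F^1=F$). Elements of $\mathcal{C}_XF^n$ are called $n$-cells; $1$-cells are called cells. A self-similar graph $X$ is homogeneously self-similar if: (H1) all cell graphs $\hat C$ ($C\in\mathcal{C}_XF$) are finite and for any cells $C,D$ there is a graph isomorphism $\alpha:\hat C\to\hat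 D$ with $\alpha(\theta C)=\theta D$; (H2) for every cell $C$ and $v_1,v_2,v_3,v_4\in\theta C$ with $v_1\neq v_2$, $v_3\ne v_4$, one has $d_X(v_1,v_2)=d_X(v_3,v_4)$. Put $\theta_X=|\theta C|$ and $\delta_X=|\delta C|$ for a cell $C$ (independent of the choice of $C$). A number $b$ is a constant inner degree of $X$ if $b=\deg_{\hat C}v$ for every cell $C$ and every $v\in\theta C$. *)

(* Defs.v *)
From mathcomp Require Import all_boot.
From mathcomp Require Import boolp classical_sets functions cardinality.

Set Implicit Arguments.
Unset Strict Implicit.
Unset Printing Implicit Defensive.

Local Open Scope classical_set_scope.

(* Number of elements of a finite set; the junk value for infinite sets is 0. *)
Definition ncard (T : Type) (A : set T) : nat :=
  xget 0 [set n : nat | (A #= `I_n)%card].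

Record graph := Graph {
  vertex :> Type;
  adj : vertex -> vertex -> Prop;
  adj_sym : forall x y, adj x y -> adj y x;
  adj_irrefl : forall x, ~ adj x x
}.

(* [f] restricts to an isomorphism from the graph with vertex set [A] and
   adjacency [r] to the graph with vertex set [B] and adjacency [s]; the values
   of [f], [r] and [s] outside of the vertex sets are irrelevant. *)
Definition graph_iso (T U : Type) (A : set T) (r : T -> T -> Prop)
    (B : set U) (s : U -> U -> Prop) (f : T -> U) : Prop :=
  set_bij A B f /\ forall x y, A x -> A y -> (r x y <-> s (f x) (f y)).

Section Graphs.
Variable X : graph.
Implicit Types (A C F : set X) (x y v : X).

(* There is a walk with [n] edges from [x] to [y], all of whose vertices
   (including [x] and [y]) belong to [A]. *)
Fixpoint walk A (n : nat) x y : Prop :=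
  match n with
  | 0 => A x /\ x = y
  | m.+1 => A x /\ exists z, adj x z /\ walk A m z y
  end.

Definition graph_connected : Prop := forall x y, exists n, walk setT n x y.

Definition locally_finite : Prop := forall x, finite_set [set y | adj x y].

Definition base_graph : Prop :=
  [/\ graph_connected, locally_finite & infinite_set [set: X]].

(* Length of a shortest walk, in a connected graph. *)
Definition dist x y : nat :=
  xget 0 [set n | walk setT n x y /\ forall m, walk setT m x y -> n <= m].

Definition vboundary C : set X :=
  [set x | ~ C x /\ exists y, C y /\ adj x y].

Definition vclosure C : set X := C `|` vboundary C.

(* An edge is represented by the set of its two end vertices. *)
Definition eboundary C : set (set X) :=
  [set e | exists x y, [/\ C x, ~ C y, adj x y & e = [set x; y]]].

(* Degree of [v] in the subgraph induced by the closure of [C]. *)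
Definition inner_degree C v : nat :=
  ncard [set w | vclosure C w /\ adj v w].

(* Vertex sets of the connected components of the complement of [F]. *)
Definition components F : set (set X) :=
  [set C | exists x, ~ F x /\ C = [set y | exists n, walk (~` F) n x y]].

(* Adjacency of the reduced graph, whose vertex set is [F]. *)
Definition reduced_adj F x y : Prop :=
  [/\ F x, F y, x <> y &
      exists C, [/\ components F C, vboundary C x & vboundary C y]].

Definition self_similar F (psi : X -> X) : Prop :=
  [/\ forall x y, F x -> F y -> ~ adj x y,
      forall C D, components F C -> components F D -> C <> D ->
        is_subset1 (vclosure C `&` vclosure D) &
      graph_iso setT (@adj X) F (reduced_adj F) psi].

Definition iterF (psi : X -> X) (n : nat) : set X := (iter n psi) @` setT.

Definition ncells (psi : X -> X) (n : nat) : set (set X) :=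
  components (iterF psi n).

Definition homogeneously_self_similar F (psi : X -> X) : Prop :=
  [/\ self_similar F psi,
      forall C, components F C -> finite_set (vclosure C),
      forall C D, components F C -> components F D ->
        exists alpha : X -> X,
          graph_iso (vclosure C) (@adj X) (vclosure D) (@adj X) alpha /\
          alpha @` vboundary C = vboundary D &
      forall C v1 v2 v3 v4, components F C ->
        vboundary C v1 -> vboundary C v2 -> vboundary C v3 -> vboundary C v4 ->
        v1 <> v2 -> v3 <> v4 -> dist v1 v2 = dist v3 v4].

Definition constant_inner_degree F (b : nat) : Prop :=
  forall C v, components F C -> vboundary C v -> inner_degree C v = b.

End Graphs.

(* Main.v *)
(* Since psi identifies X with the reduced graph X_F, an (n+1)-cell K pulls back
   along psi to an n-cell psi^-1(K), and boundary vertices correspond.  Consider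
   the pairs (v, D) where D is a 1-cell inside K and v is a vertex of D's
   boundary outside K.  Each pair carries exactly b boundary edges of K, those
   from v into D, and exactly theta - 1 boundary edges of psi^-1(K), those from
   v to the other boundary vertices of D in X_F; by (F2) every such edge belongs
   to a single pair.  Hence (theta - 1) |delta K| = b |delta psi^-1(K)|. *)
Require Import Defs.
From mathcomp Require Import all_boot all_algebra.
From mathcomp Require Import boolp classical_sets functions cardinality.

Set Implicit Arguments.
Unset Strict Implicit.
Unset Printing Implicit Defensive.

Local Open Scope classical_set_scope.
Local Open Scope ring_scope.

Import GRing.Theory Num.Theory.

(** * Cardinalities of finite sets and counting by fibres *)

Lemma card_ncard (T : Type) (A : set T) n : (A #= `I_n)%card -> ncard A = n.
Proof.
move=> An; have Am := @xgetI _ 0%N [set n | (A #= `I_n)%card] n An.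
apply/card_eq_II; apply: card_eq_trans An.
by rewrite card_eq_sym.
Qed.

Lemma finite_ncard (T : Type) (A : set T) :
  finite_set A -> (A #= `I_(ncard A))%card.
Proof. by move=> /finite_setP[n An]; rewrite (card_ncard An). Qed.

Lemma card_setD1 (T : Type) (A : set T) x n :
  (A #= `I_n)%card -> A x -> (A `\ x #= `I_n.-1)%card.
Proof.
move=> An Ax; have /finite_setP[m Am] : finite_set (A `\ x).
  by apply: finite_setD; apply/finite_setP; exists n.
have AS : (A #= `I_m.+1)%card by apply/eq_cardSP; exists x.
suff -> : n = m.+1 by [].
by apply/card_eq_II; apply: card_eq_trans AS; rewrite card_eq_sym.
Qed.

(** With [g] numbering [B] and [h y] numbering the fibre over [y], the code [g y * k + h y x] is a
    bijection by division with remainder. Using a relation spares the map from [A] to [B] any values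
    outside [A]. *)
Lemma card_fibers (T U : Type) (A : set T) (B : set U) (R : T -> U -> Prop) n k :
  (forall x, A x -> exists2 y, B y & R x y) ->
  (forall x y y', A x -> B y -> B y' -> R x y -> R x y' -> y = y') ->
  (forall y, B y -> ([set x | A x /\ R x y] #= `I_k)%card) ->
  (B #= `I_n)%card -> (A #= `I_(n * k))%card.
Proof.
move=> Rex Runi fib /card_set_bijP[g [gfun ginj gsurj]].
have /choice[h hP] : forall y, exists h : T -> nat,
    B y -> set_bij [set x | A x /\ R x y] `I_k h.
  move=> y; have [By|nBy] := pselect (B y); last by exists (fun=> 0%N).
  by have /card_set_bijP[h hb] := fib y By; exists h.
have /choice[c cP] : forall x, exists m : nat, A x -> exists y,
    [/\ B y, R x y & m = (g y * k + h y x)%N].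
  move=> x; have [Ax|nAx] := pselect (A x); last by exists 0%N.
  by have [y By Rxy] := Rex x Ax; exists (g y * k + h y x)%N => _; exists y.
have hlt x y : A x -> B y -> R x y -> (h y x < k)%N.
  by move=> Ax By Rxy; have [hf _ _] := hP y By; exact: hf.
apply/card_set_bijP; exists c; split.
- move=> x Ax /=; have [y [By Rxy ->]] := cP x Ax.
  have gy : (g y < n)%N by exact: gfun.
  apply: (@leq_trans (g y * k + k)%N); first by rewrite ltn_add2l hlt.
  by rewrite addnC -mulSn leq_mul2r gy orbT.
- move=> x x' /set_mem Ax /set_mem Ax'.
  have [y [By Rxy ->]] := cP x Ax; have [y' [By' Rxy' ->]] := cP x' Ax'.
  have hx := hlt _ _ Ax By Rxy; have hx' := hlt _ _ Ax' By' Rxy'.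
  move=> e.
  have k0 : (0 < k)%N by exact: leq_ltn_trans hx.
  have eg : g y = g y'.
    have := congr1 (fun m => m %/ k)%N e.
    by rewrite !divnMDl// !divn_small// !addn0.
  have ey : y = y' by apply: ginj; rewrite ?inE.
  subst y'; have [_ hi _] := hP y By.
  by apply: hi; rewrite ?inE//; move: e => /addnI.
- move=> m /= mlt.
  have k0 : (0 < k)%N by move: mlt; case: (k) => //; rewrite muln0.
  have [y By gy] : (g @` B) (m %/ k)%N.
    by apply: gsurj; rewrite /= ltn_divLR.
  have [_ _ hs] := hP y By.
  have [x [Ax Rxy] hx] : (h y @` [set x | A x /\ R x y]) (m %% k)%N.
    by apply: hs; rewrite /= ltn_mod.
  exists x => //; have [y' [By' Rxy' ->]] := cP x Ax.
  by rewrite -(Runi x y y')// gy hx -divn_eq.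
Qed.

(** * Reachability inside a vertex set *)

Section Walks.
Variables (X : graph) (A : set X).

Definition reach (x y : X) : Prop := exists n, walk A n x y.

Lemma reach_refl {x} : A x -> reach x x.
Proof. by exists 0%N. Qed.

Lemma reach_step {x y z} : A x -> adj x y -> reach y z -> reach x z.
Proof. by move=> Ax xy [n w]; exists n.+1; split=> //; exists y. Qed.

Lemma reach_ind (P : X -> X -> Prop) :
  (forall x, A x -> P x x) ->
  (forall x y z, A x -> adj x y -> reach y z -> P y z -> P x z) ->
  forall x y, reach x y -> P x y.
Proof.
move=> P0 PS x y [n]; elim: n x => [x [Ax <-]|n IH x [Ax [z [xz w]]]].
  exact: P0.
by apply: PS Ax xz _ (IH _ w); exists n.
Qed.

Lemma reach_memr {x y} : reach x y -> A y.
Proof. by move: x y; apply: reach_ind. Qed.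

Lemma reach_trans {x y z} : reach x y -> reach y z -> reach x z.
Proof.
move=> xy; move: x y xy z; apply: reach_ind => // x y z Ax xy _ IH t zt.
exact: reach_step Ax xy (IH _ zt).
Qed.

Lemma reach_sym {x y} : reach x y -> reach y x.
Proof.
move: x y; apply: reach_ind => [x Ax|x y z Ax xy yz zy]; first exact: reach_refl.
apply: (reach_trans zy); apply: (@reach_step _ x); last exact: reach_refl.
- exact: reach_memr zy.
- exact: adj_sym.
Qed.

End Walks.

(** * Components of the complement of a vertex set *)

Section Components.
Variables (X : graph) (G : set X).

Definition component (x : X) : set X := [set y | reach (~` G) x y].

Lemma componentP {x} : ~ G x -> components G (component x).
Proof. by exists x. Qed.

Lemma components_notin {C y} : components G C -> C y -> ~ G y.
Proof. by move=> [x [_ ->]] /reach_memr. Qed.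

Lemma components_eq {C y} : components G C -> C y -> C = component y.
Proof.
move=> [x [_ ->]] xy; apply/seteqP; split=> z /= xz.
- exact: reach_trans (reach_sym xy) xz.
- exact: reach_trans xy xz.
Qed.

Lemma components_adj {C y z} : components G C -> C y -> ~ G z -> adj y z -> C z.
Proof.
move=> CC Cy Gz yz; rewrite (components_eq CC Cy).
apply: (@reach_step _ _ _ z) => //; first exact: (components_notin CC).
exact: reach_refl.
Qed.

Lemma components_boundary {C v} : components G C -> vboundary C v -> G v.
Proof.
move=> CC [nCv [y [Cy /adj_sym yv]]]; apply: contrapT => nGv; apply: nCv.
exact: components_adj yv.
Qed.

Lemma components_disjoint {C D y} : components G C -> components G D ->
  C y -> D y -> C = D.
Proof. by move=> CC DD Cy Dy; rewrite (components_eq CC Cy) (components_eq DD Dy). Qed.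

Lemma component_refl {x} : ~ G x -> component x x.
Proof. exact: reach_refl. Qed.

End Components.

(** A walk that avoids the larger set [H] also avoids [G]. *)
Lemma components_sub (X : graph) (G H : set X) C D y : G `<=` H ->
  components G C -> components H D -> C y -> D y -> D `<=` C.
Proof.
move=> GH CC DD Cy Dy z; rewrite (components_eq DD Dy) => yz.
rewrite (components_eq CC Cy).
move: y z yz {Cy Dy}; apply: reach_ind => [x nHx|x y z nHx xy _ IH].
  by apply: reach_refl => /GH.
by apply: reach_step xy IH => /GH.
Qed.

(** * Boundary edges as ordered pairs *)

(** The outer end comes first. Ordered pairs give direct access to both ends, so boundary edges can
    be counted by fibres. *)
Definition arcs (X : graph) (C : set X) : set (X * X) :=
  [set p | [/\ ~ C p.1, C p.2 & adj p.1 p.2]].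

(** Exactly one end of a boundary edge lies in [C], so its orientation is forced. *)
Lemma card_eboundary (X : graph) (C : set X) : (eboundary C #= arcs C)%card.
Proof.
have -> : eboundary C = (fun p => [set p.2; p.1]) @` arcs C.
  apply/seteqP; split=> [_ [x [y [Cx Cy xy ->]]]|_ [[y x] [/= Cy Cx yx] <-]].
    by exists (y, x) => //; split=> //=; exact: adj_sym.
  by exists x, y; split=> //; exact: adj_sym.
apply: inj_card_eq => -[v w] [v' w'] /set_mem[/= Cv Cw _] /set_mem[/= Cv' Cw' _] e.
have [ew|ew] : [set w'; v'] w by rewrite -e; left.
- have [ev|ev] : [set w'; v'] v by rewrite -e; right.
  + by case: Cv; rewrite ev.
  + by rewrite ev ew.
- by case: Cv'; rewrite -ew.
Qed.

(** * The axioms of self-similarity and the counts for a single cell *)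

Section SelfSimilar.
Variables (X : graph) (F : set X) (psi : X -> X) (b : nat).
Hypothesis baseX : base_graph X.
Hypothesis hssX : homogeneously_self_similar F psi.
Hypothesis cidX : constant_inner_degree F b.

Let F_indep x y : F x -> F y -> ~ adj x y.
Proof. by case: hssX => -[+ _ _] _ _ _; apply. Qed.

Let cell_meet C D u v : components F C -> components F D -> u <> v ->
  vboundary C u -> vboundary C v -> vboundary D u -> vboundary D v -> C = D.
Proof.
case: hssX => -[_ F2 _] _ _ _ CC DD uv Cu Cv Du Dv.
apply: contrapT => CD; apply: uv.
by apply: (F2 _ _ CC DD CD); split; right.
Qed.

Let psiF x : F (psi x).
Proof. by case: hssX => -[_ _ [[psif _ _] _]] _ _ _; exact: psif. Qed.

Let psi_inj x y : psi x = psi y -> x = y.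
Proof.
by case: hssX => -[_ _ [[_ psii _] _]] _ _ _; apply: psii; rewrite inE.
Qed.

Let psi_surj y : F y -> exists x, y = psi x.
Proof.
case: hssX => -[_ _ [[_ _ psis] _]] _ _ _ /psis[x _ <-].
by exists x.
Qed.

Let psi_adj x y : adj x y <-> reduced_adj F (psi x) (psi y).
Proof. by case: hssX => -[_ _ [_ psia]] _ _ _; exact: psia. Qed.

Let psi_adj_cell x y : adj x y ->
  exists2 C, components F C & vboundary C (psi x) /\ vboundary C (psi y).
Proof. by move=> /psi_adj[_ _ _ [C []]]; exists C. Qed.

Let cell_adj C x y : components F C -> vboundary C (psi x) ->
  vboundary C (psi y) -> x <> y -> adj x y.
Proof.
move=> CC Cx Cy xy; apply/psi_adj; split=> //; first by move=> /psi_inj.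
by exists C.
Qed.

(** An infinite connected graph has an edge, whose [psi]-image joins two boundary vertices of some
    cell [D]; the isomorphism from (H1) carries them to [C]. *)
Lemma cell_boundary_two C : components F C ->
  exists u v, [/\ vboundary C u, vboundary C v & u <> v].
Proof.
move=> CC.
have [x [y xy]] : exists x y : X, adj x y.
  case: baseX => conX _ /infinite_setN0 infX.
  have [x _] := infX.
  have [y xy] : exists y, x <> y.
    apply: contrapT => /forallNP all_eq; case: baseX => _ _; apply.
    apply: sub_finite_set (finite_set1 x) => y _ /=.
    by apply/esym; apply: contrapT => xy; exact: all_eq xy.
  have [[|n] /=] := conX x y; first by case.
  by move=> [_ [z [xz _]]]; exists x, z.
have [D DD [Dx Dy]] := psi_adj_cell xy.
have [_ _ /(_ D C DD CC)[alpha [[[_ ainj _] _] abd]] _] := hssX.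
exists (alpha (psi x)), (alpha (psi y)); rewrite -abd; split.
- by exists (psi x).
- by exists (psi y).
- move=> e; have exy : psi x = psi y.
    by apply: ainj e; rewrite inE; right.
  by apply: (@adj_irrefl X x); move: xy; rewrite -(psi_inj exy).
Qed.

Lemma cell_boundary_other C v : components F C ->
  exists2 u, vboundary C u & u <> v.
Proof.
move=> /cell_boundary_two[u [w [Cu Cw uw]]].
have [uv|uv] := pselect (u = v); last by exists u.
by exists w => // wv; apply: uw; rewrite uv wv.
Qed.

Lemma card_cell_boundary C : components F C ->
  (vboundary C #= `I_(ncard (vboundary C)))%card.
Proof.
move=> CC; apply: finite_ncard; have [_ fin _ _] := hssX.
by apply: sub_finite_set (fin C CC) => x; right.
Qed.

(** This keeps the denominator theta - 1 of the final formula nonzero. *)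
Lemma cell_boundary_gt1 C : components F C -> (1 < ncard (vboundary C))%N.
Proof.
move=> CC; have [u [v [Cu Cv uv]]] := cell_boundary_two CC.
have c1 := card_setD1 (card_cell_boundary CC) Cu.
have : (vboundary C `\ u) v by split=> //= vu; exact: uv.
case: ncard c1 => [|[|n]]// c0; by move: c0; rewrite II0 card_eq0 => /eqP ->.
Qed.

Lemma cell_boundary_card_eq C D : components F C -> components F D ->
  ncard (vboundary C) = ncard (vboundary D).
Proof.
move=> CC DD; apply/esym/card_ncard.
have [_ _ /(_ C D CC DD)[alpha [[[_ ainj _] _] <-]] _] := hssX.
apply: card_eq_trans (card_cell_boundary CC).
apply: inj_card_eq => x y /set_mem Cx /set_mem Cy.
by apply: ainj; rewrite inE; right.
Qed.

(** By (F1) a boundary vertex has no neighbour on the boundary, so its inner degree counts only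
    neighbours in [C] itself. *)
Lemma card_cell_neighbours C v : components F C -> vboundary C v ->
  ([set w | C w /\ adj v w] #= `I_b)%card.
Proof.
move=> CC Cv; rewrite -(cidX CC Cv) /inner_degree.
have -> : [set w | vclosure C w /\ adj v w] = [set w | C w /\ adj v w].
  apply/seteqP; split=> w [Cw vw]; split=> //; last by left.
  case: Cw => // Cw; case: (F_indep _ _ vw).
    exact: components_boundary Cv.
  exact: components_boundary Cw.
apply: finite_ncard; case: baseX => _ fin _.
by apply: sub_finite_set (fin v) => w [].
Qed.

(** Grouping by outer end gives theta groups of size [b]. This is the base case of the induction and
    the value theta b of delta_X. *)
Lemma card_cell_arcs C : components F C ->
  (arcs C #= `I_(ncard (vboundary C) * b))%card.
Proof.
move=> CC.
apply: (@card_fibers _ _ _ (vboundary C) (fun p v => p.1 = v)).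
- by move=> [v w] /= [Cv Cw vw]; exists v => //; split=> //; exists w.
- by move=> x y y' _ _ _ -> ->.
- move=> v Cv; apply: card_eq_trans (card_cell_neighbours CC Cv).
  have -> : [set p | arcs C p /\ p.1 = v] =
      pair v @` [set w | C w /\ adj v w].
    apply/seteqP; split=> [[v' w] /= [[/= _ Cw vw] <-]|_ [w [Cw vw] <-]] /=.
      by exists w.
    by split=> //; split=> //=; case: Cv.
  by apply: inj_card_eq => x y _ _ [].
- exact: card_cell_boundary.
Qed.

(** * Pulling a component back along [psi] *)

Section Step.
Variables (G : set X) (K : set X).
Hypothesis GF : G `<=` F.
Hypothesis KG : components (psi @` G) K.

Let psiGF : psi @` G `<=` F.
Proof. by move=> _ [x _ <-]. Qed.

Let psiG x : (psi @` G) (psi x) -> G x.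
Proof. by move=> [y Gy /psi_inj <-]. Qed.

(** A neighbour of [K] outside [K] must be a removed vertex, hence lies in [F]; by (F1) the inner
    end [w] then does not. *)
Let K_notinF v w : ~ K v -> K w -> adj v w -> ~ F w /\ (psi @` G) v.
Proof.
move=> Kv Kw vw.
have Gv : (psi @` G) v.
  apply: contrapT => nGv; apply: Kv.
  by apply: components_adj KG Kw nGv _; exact: adj_sym.
by split=> // Fw; apply: F_indep vw => //; exact: psiGF.
Qed.

(* Two boundary vertices of a cell are [psi]-images of neighbours, and no two
   vertices of [G] are neighbours. *)
Let cell_boundary_notin D u v : components F D -> vboundary D u ->
  vboundary D v -> u <> v -> (psi @` G) v -> ~ (psi @` G) u.
Proof.
move=> DD Du Dv uv [v' Gv' ev] [u' Gu' eu].
apply: (@F_indep u' v'); [exact: GF|exact: GF|].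
apply: (cell_adj DD) => //; rewrite ?eu ?ev//.
by move=> e; apply: uv; rewrite -eu -ev e.
Qed.

Let cell_sub D w : components F D -> K w -> D w -> D `<=` K.
Proof. by move=> DD; exact: components_sub psiGF KG DD. Qed.

Let cell_sub_boundary D v : components F D -> D `<=` K -> vboundary D v ->
  ~ (psi @` G) v -> K v.
Proof.
move=> DD DK [_ [d [Dd /adj_sym dv]]] Gv.
exact: components_adj KG (DK _ Dd) Gv dv.
Qed.

Let boundary_sub_cell D v : components F D -> K v -> vboundary D v -> D `<=` K.
Proof.
move=> DD Kv [_ [d [Dd vd]]]; apply: (@cell_sub D d) => //.
by apply: components_adj KG Kv _ vd => /psiGF; exact: components_notin DD Dd.
Qed.

Let cell_of w : ~ F w -> exists2 D, components F D & D w.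
Proof. by move=> Fw; exists (component F w); [exact: componentP|exact: component_refl]. Qed.

Lemma component_meets_F : exists2 y, ~ G y & K (psi y).
Proof.
have [x nGx Kx] : exists2 x, ~ (psi @` G) x & K x.
  by case: KG => x [Gx ->]; exists x => //; exact: reach_refl.
have [Fx|nFx] := pselect (F x).
  have [y ey] := psi_surj Fx; exists y; rewrite -?ey// => Gy.
  by apply: nGx; rewrite ey; exists y.
have [D DD Dx] := cell_of nFx; have DK := cell_sub DD Kx Dx.
have [u [v [Du Dv uv]]] := cell_boundary_two DD.
have [w Dw Gw] : exists2 w, vboundary D w & ~ (psi @` G) w.
  have [Gv|Gv] := pselect ((psi @` G) v); last by exists v.
  by exists u => //; exact: cell_boundary_notin DD Du Dv uv Gv.
have [y ey] := psi_surj (components_boundary DD Dw).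
exists y; last by rewrite -ey; exact: cell_sub_boundary Dw Gw.
by move=> Gy; apply: Gw; rewrite ey; exists y.
Qed.

Lemma reach_psi x y : reach (~` G) x y ->
  reach (~` (psi @` G)) (psi x) (psi y).
Proof.
have GNpsi z : ~ G z -> ~ (psi @` G) (psi z) by move=> nGz /psiG.
move: x y; apply: reach_ind => [x Gx|x y z Gx xy yz IH].
  exact/reach_refl/GNpsi.
apply: reach_trans IH.
have nGy : ~ (psi @` G) (psi y).
  by apply: GNpsi; exact: reach_memr (reach_sym yz).
have [D DD [[_ [d [Dd xd]]] [_ [d' [Dd' /adj_sym dy]]]]] := psi_adj_cell xy.
apply: (@reach_step _ _ _ d) => //; first exact: GNpsi.
have nGz z' : ~ F z' -> ~ (psi @` G) z' by move=> nFz /psiGF.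
have dd' : reach (~` (psi @` G)) d d'.
  move: Dd'; rewrite (components_eq DD Dd) /component /=.
  move: {Dd xd} d d' {dy}; apply: reach_ind => [t /nGz|t t' t'' /nGz nGt tt' _].
    exact: reach_refl.
  exact: reach_step.
apply: reach_trans dd' _; apply: (@reach_step _ _ _ (psi y)) => //.
- by apply: nGz; exact: components_notin DD Dd'.
- exact: reach_refl.
Qed.

(* When the walk currently sits inside a cell, the claim has to be carried for
   all the boundary vertices of that cell at once. *)
Let reach_psi_inv_aux p z : reach (~` (psi @` G)) p z ->
  forall z', z = psi z' ->
  (forall q, p = psi q -> reach (~` G) q z') /\
  (forall D q, components F D -> D p -> vboundary D (psi q) -> ~ G q ->
     reach (~` G) q z').
Proof.
have GNpsi q : ~ (psi @` G) (psi q) -> ~ G q by move=> + Gq; apply; exists q.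
move: p z; apply: reach_ind => [p nGp z' ep|p p' z nGp pp' _ IH z' ez].
  split=> [q|D q DD Dp].
    rewrite ep => e; move: (e) => /psi_inj <-; apply/reach_refl/GNpsi.
    by rewrite -ep.
  by case: (components_notin DD Dp); rewrite ep.
have [IHF IHD] := IH z' ez; split=> [q ep|D q DD Dp Dq nGq].
- have nFp' : ~ F p' by move=> Fp'; apply: F_indep pp'; rewrite ?ep.
  have [D DD Dp'] := cell_of nFp'.
  apply: (IHD D) => //; last by apply: GNpsi; rewrite -ep.
  rewrite -ep; split; last by exists p'.
  by move=> /(components_notin DD); apply; rewrite ep.
- have [Fp'|nFp'] := pselect (F p'); last first.
    by apply: (IHD D) => //; exact: components_adj DD Dp nFp' pp'.
  (* The walk leaves [D] at [psi q'], so [psi q] and [psi q'] both bound [D]: [q] and [q'] are equal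
     or adjacent. *)
  have [q' eq'] := psi_surj Fp'.
  have rq' := IHF _ eq'.
  have [->//|qq'] := pselect (q = q').
  apply: reach_step rq' => //; apply: (cell_adj DD) => //.
  rewrite -eq'; split; last by exists p; split=> //; exact: adj_sym.
  by move=> /(components_notin DD).
Qed.

Lemma reach_psi_inv x y : reach (~` (psi @` G)) (psi x) (psi y) ->
  reach (~` G) x y.
Proof. by move=> /reach_psi_inv_aux /(_ y erefl)[+ _]; apply. Qed.

Lemma preimage_component : components G (psi @^-1` K).
Proof.
have [y Gy Ky] := component_meets_F; exists y; split=> //.
rewrite (components_eq KG Ky).
apply/seteqP; split=> z /=; [exact: reach_psi_inv|exact: reach_psi].
Qed.

(** * Double counting over incident pairs *)

Let incident : set (X * set X) :=
  [set p | [/\ ~ K p.1, components F p.2, p.2 `<=` K & vboundary p.2 p.1]].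

Let arc_incident v w : arcs (psi @^-1` K) (v, w) ->
  exists2 D, incident (psi v, D) & vboundary D (psi w).
Proof.
move=> [/= Kv Kw vw]; have [D DD [Dv Dw]] := psi_adj_cell vw.
exists D => //; split=> //=; exact: boundary_sub_cell Dw.
Qed.

Let arc_psi : X * X -> X * set X -> Prop :=
  fun p q => psi p.1 = q.1 /\ vboundary q.2 (psi p.2).

Let arc_psi_exists p : arcs (psi @^-1` K) p ->
  exists2 q, incident q & arc_psi p q.
Proof.
case: p => v w /arc_incident[D vD Dw].
by exists (psi v, D).
Qed.

(** The ends of an arc have distinct [psi]-images, and by (F2) two distinct vertices bound at most
    one common cell. *)
Let arc_psi_unique p q q' : arcs (psi @^-1` K) p ->
  incident q -> incident q' -> arc_psi p q -> arc_psi p q' -> q = q'.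
Proof.
case: p q q' => v w [v1 D1] [v2 D2] [/= _ _ vw] [/= _ DD1 _ D1v] [/= _ DD2 _ D2v].
move=> [/= e1 D1w] [/= e2 D2w]; subst v1 v2; congr pair.
apply: (@cell_meet _ _ (psi v) (psi w)) => //.
by move=> /psi_inj ewv; move: vw; rewrite ewv; exact: adj_irrefl.
Qed.

(** The witness [p] is the number of incident pairs; eliminating it relates the two edge
    boundaries. *)
Lemma step_card m theta : (forall D, components F D -> ncard (vboundary D) = theta) ->
  (arcs (psi @^-1` K) #= `I_m)%card ->
  exists p, m = (p * theta.-1)%N /\ (arcs K #= `I_(p * b))%card.
Proof.
move=> thetaE Am.
(* The finite set of arcs of the preimage maps onto the pairs: given [(v, D)], a second boundary
   vertex of [D] provides an arc over it. The value of [f] off the arcs is junk. *)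
have /finite_setP[p Pp] : finite_set incident.
  have /choice[f fP] : forall a, exists q,
      arcs (psi @^-1` K) a -> incident q /\ arc_psi a q.
    move=> a; have [Aa|nAa] := pselect (arcs (psi @^-1` K) a).
      by have [q] := arc_psi_exists Aa; exists q.
    by exists (a.1, set0).
  apply: (@sub_finite_set _ _ (f @` arcs (psi @^-1` K))); last first.
    by apply: finite_image; apply/finite_setP; exists m.
  move=> [v D] vD; have [/= Kv DD DK Dv] := vD.
  have [u Du uv] := cell_boundary_other v DD.
  have [v' ev] := psi_surj (components_boundary DD Dv).
  have [u' eu] := psi_surj (components_boundary DD Du).
  have Gv : (psi @` G) v.
    by apply: contrapT => nGv; apply: Kv; exact: cell_sub_boundary Dv nGv.
  have A1 : arcs (psi @^-1` K) (v', u').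
    split=> /=; rewrite -?ev -?eu//.
      by apply: (cell_sub_boundary DD DK Du);
         exact: cell_boundary_notin DD Du Dv uv Gv.
    by apply: (cell_adj DD); rewrite -?ev -?eu// => e; apply: uv; rewrite ev eu e.
  have [If Rf] := fP _ A1; exists (v', u') => //.
  by apply: arc_psi_unique A1 If vD Rf _; split=> /=; rewrite -?ev -?eu.
exists p; split.
  apply/card_eq_II; rewrite card_eq_sym in Am; apply: (card_eq_trans Am).
  apply: card_fibers arc_psi_exists arc_psi_unique _ Pp => -[v D] vD.
  have [/= Kv DD DK Dv] := vD.
  have Gv : (psi @` G) v.
    by apply: contrapT => nGv; apply: Kv; exact: cell_sub_boundary Dv nGv.
  rewrite -(thetaE _ DD).
  apply: card_eq_trans (card_setD1 (card_cell_boundary DD) Dv).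
  set S := (X in (X #= _)%card).
  have -> : vboundary D `\ v = (fun a => psi a.2) @` S.
    apply/seteqP; split=> [u [Du /= uv]|_ [[v' w'] [[/= Kv' Kw' vw] [/= ev Dw]] <-]].
      have [v' ev] := psi_surj (components_boundary DD Dv).
      have [u' eu] := psi_surj (components_boundary DD Du).
      exists (v', u') => //; split; split=> /=; rewrite -?ev -?eu//.
        by apply: (cell_sub_boundary DD DK Du);
         exact: cell_boundary_notin DD Du Dv uv Gv.
      by apply: (cell_adj DD); rewrite -?ev -?eu// => e; apply: uv; rewrite ev eu e.
    split=> //= e; apply: (@adj_irrefl X v'); move: vw.
    by rewrite -ev in e; rewrite (psi_inj e).
  rewrite card_eq_sym; apply: inj_card_eq => -[v1 w1] [v2 w2].
  move=> /set_mem[_ [/= e1 _]] /set_mem[_ [/= e2 _]] /psi_inj ->.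
  by rewrite -e2 in e1; rewrite (psi_inj e1).
(* Second count: the inner end of an arc of [K] is outside [F], so it lies in exactly one cell, and
   that cell is contained in [K]. *)
apply: (@card_fibers _ _ _ incident (fun a q => a.1 = q.1 /\ q.2 a.2)) Pp.
- move=> [v w] [/= Kv Kw vw]; have [nFw Gv] := K_notinF Kv Kw vw.
  have [D DD Dw] := cell_of nFw; have DK := cell_sub DD Kw Dw.
  exists (v, D) => //; split=> //=; split; last by exists w.
  by move=> /DK.
- move=> [v w] [v1 D1] [v2 D2] _ [_ /= DD1 _ _] [_ /= DD2 _ _] [/= <- D1w] [<- D2w].
  by rewrite (components_disjoint DD1 DD2 D1w D2w).
- move=> [v D] [/= Kv DD DK Dv].
  apply: card_eq_trans (card_cell_neighbours DD Dv).
  set S := (X in (X #= _)%card).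
  have -> : S = pair v @` [set w | D w /\ adj v w].
    apply/seteqP; split=> [[v' w] [[/= _ _ vw] [/= <- Dw]]|_ [w [Dw vw] <-]].
      by exists w.
    by split=> //; split=> //=; exact: DK.
  by apply: inj_card_eq => x y _ _ [].
Qed.

End Step.

(** * Induction on the level and the closed formula *)

Lemma iterF1 : iterF psi 1 = F.
Proof.
apply/seteqP; split=> [_ [x _ <-]|y /psi_surj[x ->]]; first exact: psiF.
by exists x.
Qed.

Lemma iterFS n : iterF psi n.+1 = psi @` iterF psi n.
Proof.
apply/seteqP; split=> [_ [x _ <-]|_ [_ [x _ <-] <-]]; last by exists x.
by rewrite iterS; exists (iter n psi x) => //; exists x.
Qed.

Lemma iterF_sub n : iterF psi n.+1 `<=` F.
Proof. by rewrite iterFS => _ [x _ <-]. Qed.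

(* Here m = |delta K| and theta b = |delta C|. *)
Lemma card_ncell_arcs C : components F C -> forall n K, ncells psi n.+1 K ->
  exists2 m, (arcs K #= `I_m)%card &
  ((ncard (vboundary C)).-1 ^ n * m = b ^ n * (ncard (vboundary C) * b))%N.
Proof.
move=> CC; elim=> [|n IH] K KK.
  rewrite /ncells iterF1 in KK.
  exists (ncard (vboundary K) * b)%N; first exact: card_cell_arcs.
  by rewrite !expn0 (cell_boundary_card_eq CC KK).
rewrite /ncells iterFS in KK.
have [m Am mE] := IH _ (preimage_component (@iterF_sub n) KK).
have thetaE D : components F D -> ncard (vboundary D) = ncard (vboundary C).
  by move=> DD; exact: cell_boundary_card_eq.
have [p [pE Kp]] := step_card (@iterF_sub n) KK thetaE Am.
(* The right side becomes b (theta - 1)^n m by induction, and m = p (theta - 1) supplies the missing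
   factor. *)
exists (p * b)%N => //; rewrite [in RHS]expnS -[in RHS]mulnA -mE pE expnS.
by rewrite mulnACA mulnC [RHS]mulnA (mulnC b) (mulnC p).
Qed.

End SelfSimilar.

(* C is an arbitrary cell: theta_X = |theta C| and delta_X = |delta C|. *)
Theorem theorem2 (X : graph) (F : set X) (psi : X -> X) (b : nat) :
  base_graph X ->
  homogeneously_self_similar F psi ->
  constant_inner_degree F b ->
  forall C : set X, components F C ->
  forall n : nat, (0 < n)%N ->
  forall Cn : set X, ncells psi n Cn ->
  finite_set (eboundary Cn) /\
  (ncard (eboundary Cn))%:R =
    (b%:R / ((ncard (vboundary C))%:R - 1)) ^+ n.-1
      * (ncard (eboundary C))%:R :> rat.
Proof.
move=> baseX hssX cidX C CC [//|n] _ K KK.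
have [m Km mE] := card_ncell_arcs baseX hssX cidX CC KK.
have eK := card_eq_trans (card_eboundary K) Km.
split; first by apply/finite_setP; exists m.
rewrite (card_ncard eK) (card_ncard (card_eq_trans (card_eboundary C)
  (card_cell_arcs baseX hssX cidX CC))) /=.
have := cell_boundary_gt1 baseX hssX CC.
(* Here theta = [t.+2], so the truncated predecessor in [mE] and the rational theta - 1 are both
   [t.+1]. *)
case: ncard mE => [//|[//|t]] /= mE _.
have t0 : (t.+1%:R : rat) != 0 by rewrite pnatr_eq0.
rewrite -[t.+2]addn1 natrD addrK expr_div_n mulrAC addn1.
apply/(canRL (mulfK _)); first by rewrite expf_neq0.
by rewrite -!natrX -!natrM mulnC mE.
Qed.
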